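(* Let $\Gamma$ be a nonempty connected graph, and let the torus $(\mathbb{G}_m)^{V_\Gamma}/\mathbb{G}_m$ (quotient by the diagonal) act on the graphical grassmannian $X(\Gamma)$ via the action of diagonal matrices on $k^{V_\Gamma}$. Then the subsets $X(\Gamma,\tau)$, $\tau\in N^+(\Gamma)$, describe the stratification of $X(\Gamma)$ by torus orbits: they are pairwise disjoint, their union is $X(\Gamma)$, and each $X(\Gamma,\tau)$ is a single orbit of $(\mathbb{G}_m)^{V_\Gamma}/\mathbb{G}_m$.
   Context: A graph is a finite simple graph $\Gamma=(V_\Gamma,E_\Gamma)$; $\Gamma_V$ denotes the induced subgraph on $V\subseteq V_\Gamma$; $k$ is a field of characteristic zero and $\mathbb{G}_m=k^\times$. $G_\Gamma$ is the set of all nonempty $T\subseteq V_\Gamma$ for which $\Gamma_T$ is connected. For $T\subseteq V_\Gamma$, $k^T\subseteq k^{V_\Gamma}$ is the coordinate subspace spanned by the basis vectors indexed by $T$. The graphical grassmannian $X(\Gamma)$ is the variety parametrising collections $\{H_T\}_{T\in G_\Gamma}$ of subspaces of $k^{V_\Gamma}$ such that $H_T\subset k^T$, $\dim H_T=|T|-1$, and $H_T\subset H_{T'}$ whenever $T\subset T'$. The torus $(\mathbb{G}_m)^{V_\Gamma}$ acts on $k^{V_\Gamma}$ by diagonal matrices, hence on collections $\{H_T\}$; the diagonal $\mathbb{G}_m$ acts trivially. $N^+(\Gamma)$ is the set of all nested sets: sets $\tau\subseteq G_\Gamma$ with $V_\Gamma\in\tau$ such that for any two distinct $T_1,T_2\in\tau$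 either one of them is a subset of the other, or $\Gamma_{T_1\cup T_2}=\Gamma_{T_1}\sqcup\Gamma_{T_2}$ (disjoint union of graphs). To $\tau\in N^+(\Gamma)$ one associates the rooted tree $\mathbb{T}_\tau$ with vertex set $\tau$, in which $T$ is the parent of $T'$ if $T$ covers $T'$ in the inclusion order restricted to $\tau$ (the root is $V_\Gamma$); the vertex $T$ is labelled by $\lambda(T)=T\setminus\bigcup_{T'\in\tau,\,T'\subsetneq T}T'$. For $\tau\in N^+(\Gamma)$, $X(\Gamma,\tau)$ is the set of all $\{H_T\}_{T\in G_\Gamma}\in X(\Gamma)$ satisfying the following two conditions: (i) for each $T\in\tau$ having a parent $T'$ in $\mathbb{T}_\tau$ and each $v\in\lambda(T')$ such that $T\cup\{v\}\in G_\Gamma$, one has $H_{T\cup\{v\}}=k^T$; (ii) for each $T\in\tau$ and each $v_1\neq v_2\in\lambda(T)$, if $T'\subset T\setminus\{v_1,v_2\}$ is such that $T'\in\tau\cup\{\emptyset\}$ and $T'\cup\{v_1\}\cup\{v_2\}\in G_\Gamma$, then $H_{T'\cup\{v_1\}\cup\{v_2\}}$ is different from $k^{T'\cup\{v_1\}}$ and from $k^{T'\cup\{v_2\}}$. *)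

(* Defs.v *)
From HB Require Import structures.
From mathcomp Require Import all_boot all_algebra.
From mathcomp Require Import boolp classical_sets.

Set Implicit Arguments.
Unset Strict Implicit.
Unset Printing Implicit Defensive.

Import GRing.Theory.
Local Open Scope ring_scope.

(* A finite simple graph on V is a symmetric irreflexive e : rel V; these two
   hypotheses are only imposed in theorems. *)
Section Graph.
Variables (V : finType) (e : rel V).
Implicit Types (T : {set V}) (tau : {set {set V}}).

Definition induced T : rel V := [rel x y | [&& x \in T, y \in T & e x y]].

Definition connected_on T : bool :=
  [forall x in T, forall y in T, connect (induced T) x y].

Definition tubes : {set {set V}} :=
  [set T | (T != finset.set0) && connected_on T].

(* Gamma_(T1 u T2) is the disjoint union of Gamma_T1 and Gamma_T2: the vertex
   sets are disjoint, and every edge of the union lies in one of the parts. *)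
Definition separated T1 T2 : bool :=
  [disjoint T1 & T2] &&
  [forall x, forall y,
     induced (T1 :|: T2) x y == induced T1 x y || induced T2 x y].

Definition nested_set tau : bool :=
  [&& tau \subset tubes, finset.setT \in tau &
      [forall T1 in tau, forall T2 in tau, (T1 != T2) ==>
         [|| T1 \subset T2, T2 \subset T1 | separated T1 T2]]].

(* parent tau T T' : T' is the parent of T in the tree of tau. *)
Definition parent tau T T' : bool :=
  [&& T \in tau, T' \in tau, T \proper T' &
      [forall S in tau, ~~ ((T \proper S) && (S \proper T'))]].

Definition label tau T : {set V} :=
  T :\: \bigcup_(T' in tau | T' \proper T) T'.

Definition tube := {T : {set V} | T \in tubes}.

End Graph.

Section MultiplicativeGroup.
Variable k : fieldType.

Record Gm := MkGm { Gm_val : k; Gm_neq0 : Gm_val != 0 }.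

HB.instance Definition _ := [isSub for Gm_val].
HB.instance Definition _ := [Choice of Gm by <:].

Definition Gm_one : Gm := MkGm (oner_neq0 k).

Lemma Gm_mul_proof (x y : Gm) : Gm_val x * Gm_val y != 0.
Proof. by rewrite mulf_neq0 // Gm_neq0. Qed.
Definition Gm_mul (x y : Gm) : Gm := MkGm (Gm_mul_proof x y).

Lemma Gm_inv_proof (x : Gm) : (Gm_val x)^-1 != 0.
Proof. by rewrite invr_eq0 Gm_neq0. Qed.
Definition Gm_inv (x : Gm) : Gm := MkGm (Gm_inv_proof x).

Lemma Gm_mulA : associative Gm_mul.
Proof. by move=> x y z; apply: val_inj; rewrite /= mulrA. Qed.
Lemma Gm_mul1 : left_id Gm_one Gm_mul.
Proof. by move=> x; apply: val_inj; rewrite /= mul1r. Qed.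
Lemma Gm_mulr1 : right_id Gm_one Gm_mul.
Proof. by move=> x; apply: val_inj; rewrite /= mulr1. Qed.
Lemma Gm_mulV : left_inverse Gm_one Gm_inv Gm_mul.
Proof. by move=> x; apply: val_inj; rewrite /= mulVf ?Gm_neq0. Qed.
Lemma Gm_mulrV : right_inverse Gm_one Gm_inv Gm_mul.
Proof. by move=> x; apply: val_inj; rewrite /= mulfV ?Gm_neq0. Qed.

HB.instance Definition _ :=
  isGroup.Build Gm Gm_mulA Gm_mul1 Gm_mulr1 Gm_mulV Gm_mulrV.

Lemma Gm_mulC (x y : Gm) : (x * y = y * x)%g.
Proof. by apply: val_inj; rewrite /= mulrC. Qed.

Lemma val_Gm1 : Gm_val (1%g : Gm) = 1. Proof. by []. Qed.
Lemma val_GmM (x y : Gm) : Gm_val (x * y)%g = Gm_val x * Gm_val y.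
Proof. by []. Qed.

End MultiplicativeGroup.

Section Torus.
Variables (k : fieldType) (V : finType).

(* A groupType for pointwise multiplication. *)
Definition torus := {ffun V -> Gm k}.
HB.instance Definition _ := Group.on torus.

Definition diagonal (c : Gm k) : torus := [ffun=> c].

Lemma torusM (s t : torus) v : (s * t)%g v = (s v * t v)%g.
Proof. by rewrite ffunE. Qed.
Lemma torus1 v : (1%g : torus) v = 1%g.
Proof. by rewrite ffunE. Qed.
Lemma torusC (s t : torus) : (s * t = t * s)%g.
Proof. by apply/ffunP => v; rewrite !torusM Gm_mulC. Qed.
Lemma diagonalE c v : diagonal c v = c.
Proof. by rewrite ffunE. Qed.
Lemma diagonalM c d : (diagonal c * diagonal d)%g = diagonal (c * d)%g.
Proof. by apply/ffunP => v; rewrite torusM !diagonalE. Qed.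
Lemma diagonal1 : diagonal 1%g = 1%g.
Proof. by apply/ffunP => v; rewrite diagonalE. Qed.

Definition diag_equiv (s t : torus) : bool :=
  `[< exists c, t = (diagonal c * s)%g >].

Lemma diag_equiv_refl : reflexive diag_equiv.
Proof. by move=> s; apply/asboolP; exists 1%g; rewrite diagonal1 mul1g. Qed.

Lemma diag_equiv_sym : symmetric diag_equiv.
Proof.
suff h s t : diag_equiv s t -> diag_equiv t s by move=> s t; apply/idP/idP; exact: h.
move=> /asboolP[c ->]; apply/asboolP; exists (c^-1)%g.
by rewrite mulgA diagonalM mulVg diagonal1 mul1g.
Qed.

Lemma diag_equiv_trans : transitive diag_equiv.
Proof.
move=> t s u /asboolP[c ->] /asboolP[d ->]; apply/asboolP.
by exists (d * c)%g; rewrite mulgA diagonalM.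
Qed.

Canonical diag_equivR :=
  EquivRel diag_equiv diag_equiv_refl diag_equiv_sym diag_equiv_trans.

(* The quotient of the torus by the diagonal. *)
Definition qtorus := {eq_quot diag_equiv}%qT.
HB.instance Definition _ := Choice.on qtorus.
HB.instance Definition _ := Quotient.on qtorus.
HB.instance Definition _ := EqQuotient.on qtorus.

Local Open Scope quotient_scope.

Definition qproj (t : torus) : qtorus := \pi_qtorus t.

Lemma qprojP (s t : torus) :
  reflect (exists c, t = (diagonal c * s)%g) (qproj s == qproj t).
Proof. by rewrite /qproj eqmodE; exact: asboolP. Qed.

Lemma qreprK (g : qtorus) : qproj (repr g) = g.
Proof. exact: reprK. Qed.

Lemma qrepr_proj (t : torus) :
  exists c, repr (qproj t) = (diagonal c * t)%g.
Proof. by apply/qprojP; rewrite qreprK. Qed.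

Definition qone : qtorus := qproj 1%g.
Definition qmul (g h : qtorus) : qtorus := qproj (repr g * repr h)%g.
Definition qinv (g : qtorus) : qtorus := qproj (repr g)^-1%g.

Lemma qmulE s t : qmul (qproj s) (qproj t) = qproj (s * t)%g.
Proof.
apply/esym/eqP/qprojP; have [c ->] := qrepr_proj s; have [d ->] := qrepr_proj t.
exists (c * d)%g; rewrite -diagonalM -!mulgA; congr (_ * _)%g.
by rewrite !mulgA (torusC s).
Qed.

Lemma qinvE t : qinv (qproj t) = qproj t^-1%g.
Proof.
apply/esym/eqP/qprojP; have [c ->] := qrepr_proj t; exists (c^-1)%g.
rewrite invgM torusC; congr (_ * _)%g.
by apply/ffunP => v; rewrite !ffunE.
Qed.

Lemma qmulA : associative qmul.
Proof.
move=> f g h; rewrite -(qreprK f) -(qreprK g) -(qreprK h) !qmulE.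
by rewrite mulgA.
Qed.
Lemma qmul1 : left_id qone qmul.
Proof. by move=> g; rewrite -(qreprK g) qmulE mul1g. Qed.
Lemma qmulr1 : right_id qone qmul.
Proof. by move=> g; rewrite -(qreprK g) qmulE mulg1. Qed.
Lemma qmulV : left_inverse qone qinv qmul.
Proof. by move=> g; rewrite -(qreprK g) qinvE qmulE mulVg. Qed.
Lemma qmulrV : right_inverse qone qinv qmul.
Proof. by move=> g; rewrite -(qreprK g) qinvE qmulE mulgV. Qed.

HB.instance Definition _ :=
  isGroup.Build qtorus qmulA qmul1 qmulr1 qmulV qmulrV.

Lemma qproj1 : qproj 1%g = 1%g. Proof. by []. Qed.
Lemma qprojM s t : qproj (s * t)%g = (qproj s * qproj t)%g.
Proof. by rewrite -qmulE. Qed.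

End Torus.

Section Grassmannian.
Variables (k : fieldType) (V : finType) (e : rel V).

Local Notation kV := {ffun V -> k^o}.

Definition basis_vec (u : V) : kV := [ffun v => (v == u)%:R].

Definition coord_space (T : {set V}) : {vspace kV} :=
  <<[seq basis_vec u | u in T]>>%VS.

Definition scale_fun (t : torus k V) (x : kV) : kV :=
  [ffun v => Gm_val (t v) * x v].

Lemma scale_fun_linear t : linear (scale_fun t).
Proof.
move=> a x y; apply/ffunP => v; rewrite !ffunE mulrDr; congr (_ + _).
by rewrite /GRing.scale /= mulrCA.
Qed.

HB.instance Definition _ t :=
  GRing.isLinear.Build k kV kV *:%R (scale_fun t) (scale_fun_linear t).

Definition diag_map (t : torus k V) : 'End(kV) := linfun (scale_fun t).

Definition collection := tube e -> {vspace kV}.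

(* The k-points of the graphical grassmannian. *)
Definition ggrass : set collection := [set H |
  [/\ forall T : tube e, (H T <= coord_space (val T))%VS,
      forall T : tube e, \dim (H T) = #|val T|.-1
    & forall T T' : tube e, val T \subset val T' -> (H T <= H T')%VS]].

Definition gstratum (tau : {set {set V}}) : set collection := [set H |
  [/\ ggrass H,
      forall (T T' : {set V}) (v : V), T \in tau -> parent tau T T' ->
        v \in label tau T' ->
        forall S : tube e, val S = T :|: [set v]%SET ->
        H S = coord_space T
    & forall (T : {set V}) (v1 v2 : V), T \in tau ->
        v1 \in label tau T -> v2 \in label tau T -> v1 != v2 ->
        forall T' : {set V}, T' \subset T :\: [set v1; v2]%SET ->
        (T' \in tau \/ T' = finset.set0) ->
        forall S : tube e, val S = T' :|: [set v1]%SET :|: [set v2]%SET ->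
        H S <> coord_space (T' :|: [set v1]%SET) /\
        H S <> coord_space (T' :|: [set v2]%SET)]].

Definition act (t : torus k V) (H : collection) : collection :=
  fun T => (diag_map t @: H T)%VS.

(* The induced action of the quotient torus; see qactE. *)
Definition qact (g : qtorus k V) (H : collection) : collection :=
  act (repr g) H.

Definition qorbit (H : collection) : set collection :=
  range (fun g : qtorus k V => qact g H).

Lemma diag_mapE t x v : diag_map t x v = Gm_val (t v) * x v.
Proof. by rewrite lfunE /= ffunE. Qed.

Lemma diag_map1 : diag_map 1%g = \1%VF.
Proof.
by apply/lfunP => x; apply/ffunP => v; rewrite diag_mapE torus1 mul1r lfunE.
Qed.

Lemma diag_mapM s t : diag_map (s * t)%g = (diag_map s \o diag_map t)%VF.
Proof.
apply/lfunP => x; apply/ffunP => v.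
by rewrite comp_lfunE !diag_mapE torusM val_GmM mulrA.
Qed.

Lemma act1 H : act 1%g H = H.
Proof. by apply/funext => T; rewrite /act diag_map1 lim1g. Qed.

Lemma actM s t H : act (s * t)%g H = act s (act t H).
Proof. by apply/funext => T; rewrite /act diag_mapM limg_comp. Qed.

Lemma act_diagonal c H : act (diagonal V c) H = H.
Proof.
apply/funext => T; rewrite /act.
have E x : diag_map (diagonal V c) x = Gm_val c *: x.
  by apply/ffunP => v; rewrite diag_mapE diagonalE ffunE.
apply/vspaceP => x; apply/memv_imgP/idP => [[y yH ->]|xH].
  by rewrite E memvZ.
exists ((Gm_val c)^-1 *: x); first by rewrite memvZ.
by rewrite E scalerA mulfV ?Gm_neq0 // scale1r.
Qed.

Lemma qactE t H : qact (qproj t) H = act t H.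
Proof. by rewrite /qact; have [c ->] := qrepr_proj t; rewrite actM act_diagonal. Qed.

Lemma qact1 H : qact 1%g H = H.
Proof. by rewrite -qproj1 qactE act1. Qed.

Lemma qactM g h H : qact (g * h)%g H = qact g (qact h H).
Proof. by rewrite -(qreprK g) -(qreprK h) -qprojM !qactE actM. Qed.

Lemma act_coord_space t T :
  (diag_map t @: coord_space T <= coord_space T)%VS.
Proof.
rewrite /coord_space limg_span; apply/span_subvP => y /mapP[x /fintype.imageP[u uT ->] ->].
have -> : diag_map t (basis_vec u) = Gm_val (t u) *: basis_vec u.
  apply/ffunP => v; rewrite diag_mapE !ffunE.
  by case: eqVneq => [->|_]; rewrite /= /GRing.scale /= ?mulr0.
by apply: memvZ; apply: memv_span; exact: fintype.image_f.
Qed.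

Lemma qact_ggrass g H : ggrass H -> ggrass (qact g H).
Proof.
case=> sub dim mono; split=> [T|T|T T' sTT'].
- exact: subv_trans (limgS _ (sub T)) (act_coord_space _ _).
- rewrite -dim limg_dim_eq //; apply/eqP; rewrite -subv0; apply/subvP => x.
  rewrite memv_cap memv_ker memv0 => /andP[_ /eqP x0]; apply/eqP/ffunP => v.
  have /eqP := diag_mapE (repr g) x v; rewrite x0 ffunE eq_sym mulf_eq0.
  by rewrite (negPf (Gm_neq0 (repr g v))) => /eqP.
- exact: limgS (mono _ _ sTT').
Qed.

End Grassmannian.

Arguments ggrass k {V} e.
Arguments gstratum k {V} e tau.

(* Main.v *)
(* H_T is the kernel of a functional phi_T on k^T, unique up to scaling, and for
   tubes U <= T either phi_T vanishes on k^U or phi_U is proportional to its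
   restriction.  A point H determines a nested set: the tubes T such that phi_U
   vanishes on k^T for every tube U strictly containing T.  Conditions (i) and
   (ii) together say exactly that, for each T in tau, the support of phi_T is
   lambda(T); this forces tau to be the nested set of H.  Given tau, H is then
   determined by the phi_T with T in tau, because every tube U meets the label
   of the least member of tau containing it.  As the labels partition the
   vertices, the torus can rescale all these phi_T to sums of coordinates. *)
From HB Require Import structures.
Require Import Defs.
From mathcomp Require Import all_boot all_algebra.

Set Implicit Arguments.
Unset Strict Implicit.
Unset Printing Implicit Defensive.

Import GRing.Theory.
Local Open Scope ring_scope.

(** * Connected vertex sets, edges and unions *)

Section Tubes.
Variables (V : finType) (e : rel V).
Hypothesis e_sym : symmetric e.
Implicit Types (T U A : {set V}) (tau : {set {set V}}).

(** Follows a path inside [T] from [x]. Connectivity of a tube is used below mostly in this form, as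
    a closure principle. *)
Lemma tube_subset_closed T A x :
  T \in tubes e -> x \in T -> x \in A ->
  (forall y z, y \in T -> z \in T -> y \in A -> e y z -> z \in A) ->
  T \subset A.
Proof.
rewrite inE => /andP[_ /forall_inP cT] xT xA step; apply/subsetP => y yT.
have /forall_inP/(_ y yT)/connectP[p] := cT x xT.
elim: p x xT xA => [|z p IH] x xT xA /=; first by move=> _ ->.
case/andP=> /and3P[_ zT exz]; apply: IH => //.
exact: step exz.
Qed.

Lemma connect_induced_mono T U :
  T \subset U -> subrel (connect (induced e T)) (connect (induced e U)).
Proof.
move=> /subsetP sTU; apply: connect_sub => x y /and3P[xT yT exy].
by apply: connect1; apply/and3P; split; rewrite ?sTU.
Qed.

(** The disjunction treats overlapping tubes and tubes joined by an edge at once: [x] reaches every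
    vertex of the union, and symmetry of [e] reverses the paths. *)
Lemma tubeU T1 T2 x y :
  T1 \in tubes e -> T2 \in tubes e -> x \in T1 -> y \in T2 ->
  (x == y) || e x y -> T1 :|: T2 \in tubes e.
Proof.
rewrite !inE => /andP[_ /forall_inP c1] /andP[_ /forall_inP c2] xT1 yT2 exy.
apply/andP; split; first by apply/set0Pn; exists x; rewrite inE xT1.
pose c := connect (induced e (T1 :|: T2)).
have c_sym : symmetric c.
  by apply: sym_connect_sym => z w; rewrite /induced /= e_sym andbCA.
have cx z : z \in T1 :|: T2 -> c x z.
  case/setUP => zT.
    apply: connect_induced_mono (subsetUl T1 T2) _ _ _.
    exact: (forall_inP (c1 x xT1)).
  apply: (@connect_trans _ _ y).
    case/orP: exy => [/eqP->|exy]; first exact: connect0.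
    by apply: connect1; rewrite /induced /= !inE xT1 yT2 orbT.
  apply: connect_induced_mono (subsetUr T1 T2) _ _ _.
  exact: (forall_inP (c2 y yT2)).
apply/forall_inP => z zT; apply/forall_inP => w wT.
by apply: (@connect_trans _ _ x); [rewrite -/c c_sym|]; apply: cx.
Qed.

Lemma tube1 v : [set v] \in tubes e.
Proof.
rewrite inE -card_gt0 cards1; apply/forall_inP => x /set1P->.
by apply/forall_inP => y /set1P->; apply: connect0.
Qed.

Lemma tube_setU1 T x v : T \in tubes e -> x \in T -> e x v -> T :|: [set v] \in tubes e.
Proof.
move=> tT xT exv; apply: (tubeU tT (tube1 v) xT (set11 v)).
by rewrite exv orbT.
Qed.

(** Without such an edge [A] would be closed under adjacency in [T], hence contain all of [T]. *)
Lemma tube_boundary T A :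
  T \in tubes e -> A \proper T -> A != set0 ->
  exists x y, [/\ x \in A, y \in T, y \notin A & e x y].
Proof.
move=> tT /properP[/subsetP sAT [z zT zA]] /set0Pn[a aA].
have [/exists_inP[x xA /exists_inP[y]]|nb] :=
  boolP [exists x in A, exists y in T :\: A, e x y].
  by rewrite inE => /andP[yA yT] exy; exists x, y.
case/negP: zA; apply: (subsetP _ z zT).
apply: (tube_subset_closed tT (sAT a aA) aA) => x y xT yT xA exy.
apply: contraNT nb => yA; apply/exists_inP; exists x => //.
by apply/exists_inP; exists y => //; rewrite inE yA.
Qed.

Lemma separated_edge T1 T2 x y :
  separated e T1 T2 -> x \in T1 -> y \in T1 :|: T2 -> e x y -> y \in T1.
Proof.
case/andP=> dT /forallP/(_ x)/forallP/(_ y)/eqP E xT1 yT exy.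
have xT2 := disjointFr dT xT1.
by move: E; rewrite /induced /= inE xT1 yT exy xT2 /= orbF andbT => <-.
Qed.

(** Separation fails through a common vertex or through an edge of the union lying in neither part;
    such an edge runs from one tube to the other. *)
Lemma tubeU_nonseparated T1 T2 :
  T1 \in tubes e -> T2 \in tubes e -> ~~ separated e T1 T2 ->
  T1 :|: T2 \in tubes e.
Proof.
move=> t1 t2; rewrite negb_and => /orP[|].
  case/pred0Pn => x /andP[x1 x2].
  by apply: (tubeU t1 t2 x1 x2); rewrite eqxx.
rewrite negb_forall => /existsP[x]; rewrite negb_forall => /existsP[y].
rewrite /induced /=.
rewrite !in_setU.
case x1: (x \in T1); case x2: (x \in T2); case y1: (y \in T1);
  case y2: (y \in T2); case exy: (e x y) => //= _.
all: try by apply: (tubeU t1 t2 x1 x2); rewrite eqxx.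
all: try by apply: (tubeU t1 t2 y1 y2); rewrite eqxx.
all: try by apply: (tubeU t1 t2 x1 y2); rewrite exy orbT.
by apply: (tubeU t1 t2 y1 x2); rewrite e_sym exy orbT.
Qed.

Lemma labelP tau T v :
  reflect (v \in T /\ forall T', T' \in tau -> T' \proper T -> v \notin T')
          (v \in label tau T).
Proof.
rewrite inE andbC; apply: (iffP andP) => -[vT nv]; split=> //.
  move=> T' T'tau pT'; apply: contra nv => vT'.
  by apply/bigcupP; exists T'; rewrite ?T'tau.
by apply/bigcupP => -[T' /andP[T'tau pT']]; apply/negP/nv.
Qed.

(** * Nested sets: least members, labels and children *)

Section Nested.
Variable tau : {set {set V}}.
Hypothesis tau_nested : nested_set e tau.

Lemma nested_tube T : T \in tau -> T \in tubes e.
Proof. by case/and3P: tau_nested => /subsetP + _ _; apply. Qed.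

Lemma nestedT : [set: V] \in tau.
Proof. by case/and3P: tau_nested. Qed.

Lemma nested_cmp T1 T2 :
  T1 \in tau -> T2 \in tau ->
  [\/ T1 \subset T2, T2 \subset T1 | separated e T1 T2].
Proof.
case/and3P: tau_nested => _ _ /forall_inP h t1 t2.
move/forall_inP/(_ T2 t2): (h T1 t1); case: eqVneq => /= [->|_] .
  by constructor 1.
by case/or3P=> ?; [constructor 1 | constructor 2 | constructor 3].
Qed.

Lemma nested_meet_cmp T1 T2 x :
  T1 \in tau -> T2 \in tau -> x \in T1 -> x \in T2 ->
  (T1 \subset T2) || (T2 \subset T1).
Proof.
move=> t1 t2 x1 x2; case: (nested_cmp t1 t2) => [->|->|] //; rewrite ?orbT //.
by case/andP=> /disjointFr/(_ x1); rewrite x2.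
Qed.

(** For a tube [U] this is the least member of [tau] containing [U]. Taking an intersection makes it
    total and visibly monotone. *)
Definition hull U := \bigcap_(T in tau | U \subset T) T.

Lemma hull_min U T : T \in tau -> U \subset T -> hull U \subset T.
Proof. by move=> tT sUT; apply: bigcap_inf; rewrite tT. Qed.

Lemma sub_hull U : U \subset hull U.
Proof. by apply/bigcapsP => T /andP[]. Qed.

Lemma hull_mono U U' : U \subset U' -> hull U \subset hull U'.
Proof.
move=> sU; apply/bigcapsP => T /andP[tT sT].
exact: hull_min tT (subset_trans sU sT).
Qed.

(** Members of [tau] containing [U] share a vertex, so they are pairwise comparable, and one of
    least cardinality lies in all the others. *)
Lemma hull_nested U : U \in tubes e -> hull U \in tau.
Proof.
rewrite inE => /andP[/set0Pn[x xU] _].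
pose P T := (T \in tau) && (U \subset T).
have P0 : P [set: V] by rewrite /P nestedT subsetT.
have [T /andP[tT sUT] Tmin] := arg_minnP (fun T : {set V} => #|T|) P0.
suff -> : hull U = T by [].
apply/eqP; rewrite eqEsubset hull_min //=; apply/bigcapsP => T' /andP[tT' sUT'].
have /orP[//|sT'] :=
  nested_meet_cmp tT tT' (subsetP sUT x xU) (subsetP sUT' x xU).
have /eqP <- // : T' == T.
by rewrite eqEcard sT' Tmin // /P tT'.
Qed.

(* The maximal members of tau strictly inside T are pairwise separated, so a
   tube of T missing the label would lie inside one of them. *)
Lemma hull_label_meet U :
  U \in tubes e -> exists2 v, v \in U & v \in label tau (hull U).
Proof.
move=> tU; have tT := hull_nested tU; set T := hull U in tT *.
apply/exists_inP; apply: contraT; rewrite negb_exists_in => /forall_inP nl.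
have cov x : x \in U -> exists T', [/\ T' \in tau, T' \proper T & x \in T'].
  move=> xU; have := nl x xU; rewrite inE (subsetP (sub_hull U) x xU) andbT negbK.
  by case/bigcupP => T' /andP[? ?] ?; exists T'.
have /set0Pn[x xU] : U != set0 by move: tU; rewrite inE; case/andP.
have [T0 [tT0 pT0 xT0]] := cov x xU.
pose P T' := [&& T' \in tau, T' \proper T & x \in T'].
have P0 : P T0 by apply/and3P.
have [T1 /and3P[tT1 pT1 xT1] T1max] := arg_maxnP (fun T : {set V} => #|T|) P0.
suff sUT1 : U \subset T1.
  by move: pT1; rewrite properE (hull_min tT1 sUT1) andbF.
apply: (tube_subset_closed tU xU xT1) => y z yU zU yT1 eyz.
have [T2 [tT2 pT2 zT2]] := cov z zU.
have [s12|s21|sep] := nested_cmp tT1 tT2.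
- have /eqP-> // : T1 == T2.
  rewrite eqEcard s12; apply: T1max.
  by rewrite /P tT2 pT2 (subsetP s12).
- exact: (subsetP s21).
- by apply: (separated_edge sep yT1) => //; rewrite inE zT2 orbT.
Qed.

(** A smaller member containing [v] would remove [v] from the label. Hence labels of distinct
    members are disjoint. *)
Lemma label_hull T v : T \in tau -> v \in label tau T -> T = hull [set v].
Proof.
move=> tT /labelP[vT vmin]; apply/eqP; rewrite eq_sym.
have sT : hull [set v] \subset T by rewrite hull_min ?sub1set.
apply: contraT => neT; move: (sub_hull [set v]); rewrite sub1set => vh.
have := vmin _ (hull_nested (tube1 v)); rewrite vh; apply.
by rewrite properEneq neT.
Qed.

Lemma exists_child T T0 :
  T \in tau -> T0 \in tau -> T0 \proper T ->
  exists2 T1, parent tau T1 T & T0 \subset T1.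
Proof.
move=> tT tT0 pT0.
pose P T' := [&& T' \in tau, T' \proper T & T0 \subset T'].
have P0 : P T0 by apply/and3P.
have [T1 /and3P[tT1 pT1 sT1] T1max] := arg_maxnP (fun T : {set V} => #|T|) P0.
exists T1 => //; rewrite /parent tT1 tT pT1; apply/forall_inP => S tS.
apply/negP => /andP[pS1 pS]; have := proper_card pS1.
rewrite ltnNge; apply/negP; rewrite negbK; apply: T1max.
by rewrite /P tS pS (subset_trans sT1) ?proper_sub.
Qed.

(** Suppose a member strictly inside [T] contained [v]. It would lie in [T1], or contain the child
    [T1] and so equal it, or be separated from [T1]; in the last case the edge itself forces [v]
    into [T1]. *)
Lemma child_edge_label T T1 x v :
  parent tau T1 T -> x \in T1 -> v \in T -> v \notin T1 -> e x v ->
  v \in label tau T.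
Proof.
case/and4P=> tT1 tT pT1 /forall_inP T1max xT1 vT vT1 exv.
apply/labelP; split=> // T2 tT2 pT2; apply: contra vT1 => vT2.
case: (nested_cmp tT1 tT2) => [s12|s21|sep]; last first.
- by apply: (separated_edge sep xT1) => //; rewrite inE vT2 orbT.
- exact: (subsetP s21).
- have := T1max _ tT2; rewrite pT2 andbT properE s12 negbK => s21.
  exact: (subsetP s21).
Qed.

End Nested.
End Tubes.

(** * Coordinate subspaces and their hyperplanes *)

Section CoordinateSpaces.
Variables (k : fieldType) (V : finType).
Local Notation kV := {ffun V -> k^o}.
Local Notation basis_vec := (@basis_vec k V).
Local Notation coord_space := (@coord_space k V).
Implicit Types (T U : {set V}) (x y : kV).

Lemma ffun_sum_basis x : x = \sum_v x v *: basis_vec v.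
Proof.
apply/ffunP => v; rewrite sum_ffunE (bigD1 v) //= big1 ?addr0 => [|u neu].
  by rewrite !ffunE eqxx /GRing.scale /= mulr1.
by rewrite !ffunE eq_sym (negPf neu) /GRing.scale /= mulr0.
Qed.

Lemma basis_vec_coord T v : v \in T -> basis_vec v \in coord_space T.
Proof. by move=> vT; apply/memv_span/image_f. Qed.

Lemma mem_coord_space T x :
  reflect (forall v, v \notin T -> x v = 0) (x \in coord_space T).
Proof.
apply: (iffP idP) => [xT v vT|x0].
  rewrite (coord_span xT) sum_ffunE big1 // => i _.
  set X := image_tuple _ _ in i *.
  have /imageP[u uT ->] : X`_i \in [seq basis_vec u | u in T].
    by rewrite mem_nth // size_tuple.
  rewrite !ffunE; case: eqVneq => [vu|_]; last by rewrite /GRing.scale /= mulr0.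
  by rewrite vu uT in vT.
rewrite (ffun_sum_basis x); apply: memv_suml => v _.
have [vT|vT] := boolP (v \in T); first by rewrite memvZ ?basis_vec_coord.
by rewrite x0 // scale0r mem0v.
Qed.

Lemma basis_vec_coordE T v : (basis_vec v \in coord_space T) = (v \in T).
Proof.
apply/mem_coord_space/idP => [h|vT u uT].
  apply: contraT => /h; rewrite ffunE eqxx => /eqP.
  by rewrite oner_eq0.
by rewrite ffunE; case: eqVneq uT => // ->; rewrite vT.
Qed.

Lemma coord_space_subv T (W : {vspace kV}) :
  reflect (forall v, v \in T -> basis_vec v \in W) (coord_space T <= W)%VS.
Proof.
rewrite /Defs.coord_space; apply: (iffP span_subvP) => h v.
  by move=> vT; apply/h/image_f.
by case/imageP => u uT ->; apply: h.
Qed.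

Lemma coord_space_mono T U : T \subset U -> (coord_space T <= coord_space U)%VS.
Proof.
by move=> /subsetP s; apply/coord_space_subv => v /s; apply: basis_vec_coord.
Qed.

Lemma dim_coord_space T : \dim (coord_space T) = #|T|.
Proof.
suff /eqP : free [seq basis_vec u | u in T] by rewrite size_image.
apply/(@freeP _ _ _ (image_tuple basis_vec T)) => c c0 i.
move/ffunP/(_ (enum_val i)): c0; rewrite sum_ffunE ffunE (bigD1 i) //= big1.
  by rewrite addr0 nth_image !ffunE eqxx /GRing.scale /= mulr1.
move=> j neji; rewrite nth_image !ffunE (inj_eq enum_val_inj) eq_sym (negPf neji).
by rewrite /GRing.scale /= mulr0.
Qed.

(* A hyperplane of a coordinate space is the kernel of a functional: if it
   misses e_w, every e_v is congruent to a multiple of e_w modulo it. *)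
Lemma hyperplane_functional T (W : {vspace kV}) :
  T != set0 -> (W <= coord_space T)%VS -> \dim W = #|T|.-1 ->
  exists c : V -> k, forall x, x \in coord_space T ->
    (x \in W) = (\sum_v c v * x v == 0).
Proof.
move=> T0 sW dW.
have [w wT wW] : exists2 w, w \in T & basis_vec w \notin W.
  apply/exists_inP; apply: contraT; rewrite negb_exists_in => /forall_inP h.
  have /dimvS : (coord_space T <= W)%VS.
    by apply/coord_space_subv => v /h; rewrite negbK.
  by rewrite dim_coord_space dW leqNgt prednK ?leqnn // card_gt0.
have ew0 : basis_vec w != 0 by apply: contraNneq wW => ->; rewrite mem0v.
have decomp v : v \in T -> exists c, basis_vec v - c *: basis_vec w \in W.
  move=> vT; have : basis_vec v \in (W + <[basis_vec w]>)%VS.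
    suff -> : (W + <[basis_vec w]>)%VS = coord_space T by apply: basis_vec_coord.
    apply/eqP; rewrite eqEdim subv_add sW -memvE basis_vec_coord //=.
    rewrite dimv_disjoint_sum.
      by rewrite dim_coord_space dW dim_vline ew0 addn1 prednK // card_gt0.
    apply/eqP; rewrite -subv0; apply/subvP => x; rewrite memv_cap memv0.
    case/andP => xW /vlineP[a xa]; rewrite xa scaler_eq0; apply/orP; left.
    apply: contraNT wW => a0.
    by move: xW; rewrite xa => /(memvZ a^-1); rewrite scalerA mulVf // scale1r.
  case/memv_addP => u uW [_ /vlineP[c ->] ->]; by exists c; rewrite addrK.
(* Off [T] the coefficient defaults to 0, which is harmless because [x] vanishes there. *)
have /fin_all_exists[c cP] v : exists c, v \in T -> basis_vec v - c *: basis_vec w \in W.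
  by have [/decomp[c ?]|] := boolP (v \in T); [exists c | exists 0].
exists c => x /mem_coord_space xT; set s := \sum_v _.
have xs : x - s *: basis_vec w \in W.
  rewrite {1}(ffun_sum_basis x) scaler_suml -sumrB; apply: memv_suml => v _.
  have [vT|vT] := boolP (v \in T); last first.
    by rewrite xT // mulr0 !scale0r subr0 mem0v.
  by rewrite mulrC -scalerA -scalerBr memvZ // cP.
have -> : (x \in W) = (s *: basis_vec w \in W).
  by rewrite -[x in LHS](subrK (s *: basis_vec w)) rpredDl.
apply/idP/eqP => [sW'|->]; last by rewrite scale0r mem0v.
apply/eqP; apply: contraNT wW => s0.
by move: sW' => /(memvZ s^-1); rewrite scalerA mulVf // scale1r.
Qed.

End CoordinateSpaces.

(** * Supports of functionals and the nested set of a point *)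

Section Supports.
Variables (k : fieldType) (V : finType) (e : rel V).
Hypothesis e_sym : symmetric e.
Local Notation basis_vec := (@basis_vec k V).
Local Notation coord_space := (@coord_space k V).
Implicit Types (H : collection k e) (T U : tube e) (tau : {set {set V}}).

Definition mkTube (S : {set V}) (tS : S \in tubes e) : tube e :=
  exist (fun S => S \in tubes e) S tS.

Lemma tube_neq0 T : val T != set0.
Proof. by have := valP T; rewrite inE => /andP[]. Qed.

(* The support of a functional on k^T with kernel H_T. *)
Definition supp H T : {set V} := [set v in val T | basis_vec v \notin H T].

Lemma suppP H T v :
  reflect (v \in val T /\ basis_vec v \notin H T) (v \in supp H T).
Proof. by rewrite inE; apply: andP. Qed.

Section Fixed.
Variable H : collection k e.
Hypothesis H_ggrass : ggrass k e H.

Lemma supp_neq0 T : exists v, v \in supp H T.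
Proof.
have [_ dH _] := H_ggrass.
apply/existsP; apply: contraT; rewrite negb_exists => /forallP h.
have /dimvS : (coord_space (val T) <= H T)%VS.
  apply/coord_space_subv => v vT; apply: contraNT (h v) => vH.
  exact/suppP.
by rewrite dim_coord_space dH leqNgt prednK ?leqnn // card_gt0 tube_neq0.
Qed.

(** [H U] lies in the intersection of [H T] with the coordinate space of [U]. That intersection
    misses [basis_vec v], so it has dimension less than the size of [U], and the dimension of [H U]
    forces equality. *)
Lemma ggrass_restrict T U v x :
  val U \subset val T -> v \in val U -> v \in supp H T ->
  x \in coord_space (val U) -> (x \in H U) = (x \in H T).
Proof.
have [sH dH mH] := H_ggrass => sUT vU /suppP[_ vH] xU.
suff -> : H U = (H T :&: coord_space (val U))%VS by rewrite memv_cap xU andbT.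
apply/eqP; rewrite eqEdim subv_cap mH // sH dH /= -ltnS prednK; last first.
  by rewrite card_gt0 tube_neq0.
rewrite ltn_neqAle -(dim_coord_space k) dimvS ?capvSr // andbT.
have := dimv_leqif_eq (capvSr (H T) (coord_space (val U))).
case=> _ ->; apply: contra vH => /eqP E.
have := basis_vec_coord k vU.
by rewrite -E memv_cap => /andP[].
Qed.

Lemma supp_restrict T U v :
  val U \subset val T -> v \in val U -> v \in supp H T ->
  supp H U = supp H T :&: val U.
Proof.
move=> sUT vU vT; apply/setP => u; rewrite !inE.
have [uU|] := boolP (u \in val U); last by rewrite andbF.
rewrite (ggrass_restrict sUT vU vT) ?basis_vec_coord //.
by rewrite (subsetP sUT) ?andbT.
Qed.

Definition nested_of : {set {set V}} :=
  [set T in tubes e |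
    [forall U : tube e, (T \proper val U) ==> [disjoint supp H U & T]]].

Lemma nested_ofP T :
  reflect (forall U, val T \proper val U -> [disjoint supp H U & val T])
          (val T \in nested_of).
Proof.
rewrite inE (valP T); apply: (iffP forallP) => h U; first exact/implyP.
exact/implyP/h.
Qed.

(** If two incomparable members were not separated, their union would be a tube strictly containing
    both. Its nonempty support would have to miss each of them. *)
Lemma nested_of_nested : setT \in tubes e -> nested_set e nested_of.
Proof.
move=> V_conn; apply/and3P; split.
- by apply/subsetP => T; rewrite inE => /andP[].
- pose TV : tube e := mkTube V_conn.
  apply/(nested_ofP TV) => U.
  by rewrite properE subsetT andbF.
apply/forall_inP => S1 S1n; apply/forall_inP => S2 S2n; apply/implyP => _.
have t1 : S1 \in tubes e by case/setIdP: S1n.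
have t2 : S2 \in tubes e by case/setIdP: S2n.
apply: contraT; rewrite !negb_or => /and3P[n12 n21 nsep].
pose U : tube e := mkTube (tubeU_nonseparated e_sym t1 t2 nsep).
have [v vU] := supp_neq0 U.
have d1 : [disjoint supp H U & S1].
  apply: (nested_ofP (mkTube t1) S1n U).
  by rewrite properE subsetUl subUset subxx.
have d2 : [disjoint supp H U & S2].
  apply: (nested_ofP (mkTube t2) S2n U).
  by rewrite properE subsetUr subUset subxx andbT.
case/suppP: (vU) => /setUP[v1|v2] _.
- by rewrite (disjointFr d1 vU) in v1.
- by rewrite (disjointFr d2 vU) in v2.
Qed.

Definition supp_label tau :=
  forall T, val T \in tau -> supp H T = label tau (val T).

(* A maximal tube C in T containing x and avoiding supp H T is in nested_of:
   for a tube U containing C but not inside T, pass to U :|: T. *)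
Lemma nested_of_label : supp_label nested_of.
Proof.
move=> T Tn; apply/setP => x; apply/idP/labelP => [xs|[xT xmin]].
  case/suppP: (xs) => xT _; split=> // S Sn pS.
  have tS : S \in tubes e by case/setIdP: Sn.
  by rewrite (disjointFr (nested_ofP (mkTube tS) Sn T pS) xs).
apply: contraT => xs.
pose P (C : {set V}) :=
  [&& C \in tubes e, C \subset val T, x \in C & [disjoint supp H T & C]].
have P0 : P [set x].
  rewrite /P tube1 sub1set xT set11 /= disjoint_sym.
  by apply/pred0P => y /=; rewrite in_set1; case: eqVneq => // ->; rewrite (negPf xs).
have [C /and4P[tC sCT xC dC] Cmax] := arg_maxnP (fun C : {set V} => #|C|) P0.
pose TC : tube e := mkTube tC.
have Cn : C \in nested_of.
  apply/(nested_ofP TC) => U pCU; have sCU := proper_sub pCU.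
  have [sUT|nUT] := boolP (val U \subset val T).
    (* By maximality of [C] the larger tube [U] meets [supp H T], so [supp H U] is a part of
       [supp H T] and avoids [C]. *)
    have [v vU vT] : exists2 v, v \in supp H T & v \in val U.
      apply/exists_inP; apply: contraT => dU.
      have := proper_card pCU; rewrite ltnNge; apply: contraNT => _.
      apply: Cmax; rewrite /P (valP U) sUT (subsetP sCU x xC) /=.
      apply/pred0P => v /=; apply: contraNF dU => /andP[vT vU].
      by apply/exists_inP; exists v.
    rewrite (supp_restrict sUT vT vU).
    by apply: disjointWl dC; apply: subsetIl.
  (* The support of this union misses [T], hence meets [U]; its part in [U] is [supp H U], which
     therefore avoids [C]. *)
  have tUT : val U :|: val T \in tubes e.
    by apply: (tubeU e_sym (valP U) (valP T) (subsetP sCU x xC) xT); rewrite eqxx.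
  pose W : tube e := mkTube tUT.
  have dT : [disjoint supp H W & val T].
    by apply: (nested_ofP T Tn W); rewrite properE subsetUr subUset subxx andbT.
  have [w wW] := supp_neq0 W.
  have wU : w \in val U.
    by case/suppP: (wW) => /setUP[//|wT] _; rewrite (disjointFr dT wW) in wT.
  rewrite (supp_restrict (subsetUl _ _ : val U \subset val W) wU wW).
  apply: disjointWl (subsetIl _ _) _.
  by apply: disjointWr dT.
have := xmin _ Cn; rewrite xC; apply.
rewrite properEneq sCT andbT; apply/eqP => CT.
have [w wT] := supp_neq0 T.
have := disjointFr dC wT; rewrite CT.
by case/suppP: wT => ->.
Qed.

(** * Equivalence of the stratum conditions with prescribed supports *)

Section Characterisation.
Variable tau : {set {set V}}.
Hypothesis tau_nested : nested_set e tau.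

Let hull_tube U : hull tau (val U) \in tubes e.
Proof. exact: (nested_tube tau_nested (hull_nested tau_nested (valP U))). Qed.

(** A tube [U] strictly containing a member [S] has support inside the label of [hull tau U], which
    misses [S]. Conversely, if [S] in [nested_of] differed from its hull, the label of the hull
    would miss [S], against [hull_label_meet]. *)
Lemma supp_label_nested_of : supp_label tau -> tau = nested_of.
Proof.
move=> tauH; apply/setP => S; apply/idP/idP => Sin.
  have tS := nested_tube tau_nested Sin.
  apply/(nested_ofP (mkTube tS)) => U /= pSU.
  pose T : tube e := mkTube (hull_tube U).
  have Ttau : val T \in tau := hull_nested tau_nested (valP U).
  have [v vU vT] := hull_label_meet tau_nested (valP U).
  have sUT : val U \subset val T by apply: sub_hull.
  rewrite (supp_restrict sUT vU) tauH //.
  apply: disjointWl (subsetIl _ _) _.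
  apply/pred0P => u /=; apply/negP => /andP[/labelP[_ /(_ S Sin) h]].
  by apply/negP/h/(proper_sub_trans pSU).
have tS : S \in tubes e by case/setIdP: Sin.
pose S' : tube e := mkTube tS.
pose T : tube e := mkTube (hull_tube S').
have Ttau : val T \in tau := hull_nested tau_nested tS.
have [v vS vT] := hull_label_meet tau_nested tS.
have [<- //|neq] := eqVneq (val T) S.
have pST : val S' \proper val T by rewrite properEneq eq_sym neq sub_hull.
have := nested_ofP S' Sin T pST; rewrite tauH // => /disjointFr/(_ vT).
by rewrite /= vS.
Qed.

Lemma supp_label_hull T U v :
  supp_label tau -> val T \in tau -> val U \subset val T -> v \in val U ->
  v \in label tau (val T) -> supp H U = label tau (val T) :&: val U.
Proof. by move=> tauH tT sUT vU vT; rewrite (supp_restrict sUT vU) tauH. Qed.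

(** For (i), the support at the child plus [v] is only [v], so the hyperplane contains, and by
    dimension equals, the child's coordinate space. For (ii), both [v1] and [v2] lie in the support,
    so neither basis vector is in the hyperplane. *)
Lemma supp_label_gstratum : supp_label tau -> gstratum k e tau H.
Proof.
have [_ dH _] := H_ggrass => tauH; split=> //.
  move=> S T v Stau /and4P[_ Ttau /[dup] pST /proper_sub sST _] vT U eU.
  have tT := nested_tube tau_nested Ttau.
  have /labelP[vT' vmin] := vT.
  have vS := vmin S Stau pST.
  have sU : val U = v |: S by rewrite eU setUC.
  have sUT : val U \subset T by rewrite sU subUset sub1set vT'.
  have vU : v \in val U by rewrite sU setU11.
  apply/eqP; rewrite eq_sym eqEdim dH dim_coord_space sU cardsU1 vS /= leqnn andbT.
  apply/coord_space_subv => u uS; apply: contraT => uH.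
  have : u \in supp H U by apply/suppP; rewrite sU !inE uS orbT.
  rewrite (supp_label_hull (T := mkTube tT) tauH Ttau sUT vU vT) /=.
  by case/setIP => /labelP[_ /(_ S Stau pST)]; rewrite uS.
move=> T v1 v2 Ttau v1T v2T ne T' sT' _ S eS.
have tT := nested_tube tau_nested Ttau.
have /labelP[v1T' _] := v1T; have /labelP[v2T' _] := v2T.
have sST : val S \subset T.
  rewrite eS !subUset !sub1set v1T' v2T' !andbT.
  by apply: subset_trans sT' (subsetDl _ _).
have v1S : v1 \in val S by rewrite eS !inE eqxx orbT.
have v2S : v2 \in val S by rewrite eS !inE eqxx !orbT.
have E := supp_label_hull (T := mkTube tT) tauH Ttau sST v1S v1T.
have /suppP[_ v1H] : v1 \in supp H S by rewrite E inE v1T.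
have /suppP[_ v2H] : v2 \in supp H S by rewrite E inE v2T.
split=> HS; [move: v1H|move: v2H]; rewrite HS basis_vec_coordE !inE eqxx orbT //.
Qed.

(** If [v2] were outside the support, only [v1] would remain in the support on [S] with [v1] and
    [v2] added. The hyperplane there would be the coordinate space omitting [v1], which (ii)
    forbids. *)
Lemma gstratum_label_step T S v1 v2 :
  gstratum k e tau H -> val T \in tau -> S \in tau \/ S = set0 ->
  S \subset val T :\: [set v1; v2] -> [disjoint supp H T & S] ->
  v1 \in supp H T -> v1 \in label tau (val T) -> v2 \in label tau (val T) ->
  S :|: [set v1] :|: [set v2] \in tubes e -> v2 \in supp H T.
Proof.
have [_ dH _] := H_ggrass.
case=> _ _ str Ttau Stau sS dS v1s v1T v2T tU.
have [<- //|ne] := eqVneq v1 v2.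
pose U : tube e := mkTube tU.
have [_ neU] := str (val T) v1 v2 Ttau v1T v2T ne S sS Stau U erefl.
apply: contraT => v2s; case: neU.
have v1U : v1 \in val U by rewrite !inE eqxx orbT.
have v1S : v1 \notin S.
  by apply: contraTN sS => v1S; apply/subsetPn; exists v1; rewrite // !inE eqxx.
have sUT : val U \subset val T.
  have /labelP[v1T' _] := v1T; have /labelP[v2T' _] := v2T.
  rewrite !subUset !sub1set v1T' v2T' !andbT.
  by apply: subset_trans sS (subsetDl _ _).
have sU : val U = v1 |: (S :|: [set v2]) by rewrite /= setUAC [RHS]setUC.
apply/eqP; rewrite eq_sym eqEdim dH dim_coord_space sU cardsU1.
rewrite in_setU in_set1 (negPf ne) (negPf v1S) /= leqnn andbT.
apply/coord_space_subv => u uS.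
have uU : u \in val U by rewrite sU inE uS orbT.
rewrite (ggrass_restrict sUT v1U v1s) ?basis_vec_coord //.
apply: contraT => uH.
have us : u \in supp H T by apply/suppP; rewrite (subsetP sUT).
case/setUP: uS => [uS|/set1P uv]; first by rewrite (disjointFr dS us) in uS.
by rewrite uv (negPf v2s) in us.
Qed.

(** A support vertex [x] outside the label lies in a child [S]. An edge leaving [S] inside [T] ends
    at a label vertex [v], and (i) for [S] and [v] puts [basis_vec x] in the hyperplane, a
    contradiction by restriction from [T]. *)
Lemma gstratum_supp_sub T :
  gstratum k e tau H -> val T \in tau -> supp H T \subset label tau (val T).
Proof.
move=> str Ttau; have [_ str1 _] := str.
apply/subsetP => x xs; apply: contraT => xl.
have [xT xH] := suppP _ _ _ xs.
have [S0 /andP[S0tau pS0] xS0] : exists2 S, (S \in tau) && (S \proper val T) & x \in S.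
  by move: xl; rewrite inE xT andbT negbK => /bigcupP[S ? ?]; exists S.
have [S parS sS0] := exists_child Ttau S0tau pS0.
have xS := subsetP sS0 x xS0.
have /and4P[Stau _ pS _] := parS.
have S0' : S != set0 by apply/set0Pn; exists x.
have [y [v [yS vT vS eyv]]] := tube_boundary (valP T) pS S0'.
have vl := child_edge_label tau_nested parS yS vT vS eyv.
pose U : tube e := mkTube (tube_setU1 e_sym (nested_tube tau_nested Stau) yS eyv).
have HU := str1 S (val T) v Stau parS vl U erefl.
have xU : x \in val U by rewrite inE xS.
have sUT : val U \subset val T by rewrite subUset sub1set vT proper_sub.
have := basis_vec_coord k xS.
by rewrite -HU (ggrass_restrict sUT xU xs) ?basis_vec_coord // (negPf xH).
Qed.

(* The supp of T, enlarged by the children of T adjacent to it, is closed under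
   adjacency in T. *)
Lemma gstratum_supp_label : gstratum k e tau H -> supp_label tau.
Proof.
move=> str T Ttau; have sub := gstratum_supp_sub str Ttau.
apply/eqP; rewrite eqEsubset sub /=; apply/subsetP => w wl.
pose A := [set x | (x \in supp H T) ||
  [exists S : {set V}, [&& parent tau S (val T), x \in S &
     [exists y in S, exists v in supp H T, e y v]]]].
have [v0 v0s] := supp_neq0 T.
have childD S v1 v2 : parent tau S (val T) -> v1 \in label tau (val T) ->
    v2 \in label tau (val T) -> S \subset val T :\: [set v1; v2].
  case/and4P=> Stau _ pS _ /labelP[_ l1] /labelP[_ l2].
  rewrite subsetD proper_sub //=; apply/pred0P => x /=; rewrite !inE.
  apply/negP => /andP[xS /orP[]/eqP xv]; rewrite xv in xS.
    by case/negP: (l1 S Stau pS).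
  by case/negP: (l2 S Stau pS).
have dS S : parent tau S (val T) -> [disjoint supp H T & S].
  case/and4P=> Stau _ pS _; apply/pred0P => x /=; apply/negP => /andP[xs].
  by apply/negP; have /labelP[_ ] := subsetP sub x xs; apply.
have AT : val T \subset A.
  have v0T : v0 \in val T by case/suppP: v0s.
  have v0A : v0 \in A by rewrite inE v0s.
  apply: (tube_subset_closed (valP T) v0T v0A) => y z yT zT.
  rewrite [y \in A]in_set [z \in A]in_set => yA eyz.
  (* A label vertex enters the support by (ii), with [set0] or the intermediate child as connecting
     set. Any other [z] lies in a child: one adjacent to [y] in the support, or the child already
     containing [y]. *)
  have [zl|zl] := boolP (z \in label tau (val T)).
    apply/orP; left; case/orP: yA => [ys|].
      apply: (@gstratum_label_step T set0 y z) => //; first by right.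
      - exact: sub0set.
      - by rewrite disjoint_sym disjoints_subset sub0set.
      - exact: (subsetP sub).
      - by rewrite set0U; apply: (tube_setU1 e_sym (tube1 e y) (set11 y)).
    case/existsP => S /and3P[parS yS /exists_inP[u uS /exists_inP[v vs euv]]].
    have Stau : S \in tau by case/and4P: parS.
    have vl := subsetP sub v vs.
    apply: (@gstratum_label_step T S v z) => //; first by left.
    - exact: childD.
    - exact: dS.
    have tS := nested_tube tau_nested Stau.
    apply: (tube_setU1 e_sym (tube_setU1 e_sym tS uS euv) _ eyz).
    by rewrite inE yS.
  have [S0 /andP[S0tau pS0] zS0] : exists2 S, (S \in tau) && (S \proper val T) & z \in S.
    by move: zl; rewrite inE zT andbT negbK => /bigcupP[S ? ?]; exists S.
  have [S parS sS0] := exists_child Ttau S0tau pS0.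
  have zS := subsetP sS0 z zS0.
  apply/orP; right; case/orP: yA => [ys|].
    apply/existsP; exists S; rewrite parS zS; apply/exists_inP; exists z => //.
    by apply/exists_inP; exists y; rewrite // e_sym.
  case/existsP => S' /and3P[parS' yS' adj].
  apply/existsP; exists S'; rewrite parS' adj andbT /=.
  apply: contraT => zS'; case/negP: zl.
  exact: child_edge_label parS' yS' zT zS' eyz.
have wT : w \in val T by case/labelP: wl.
have := subsetP AT w wT; rewrite inE => /orP[//|].
case/existsP => S /and3P[/and4P[Stau _ pS _] wS _].
by have /labelP[_ /(_ S Stau pS)] := wl; rewrite wS.
Qed.

End Characterisation.
End Fixed.
End Supports.

(** * Base points of strata and transitivity of the torus *)

Section Orbits.
Variables (k : fieldType) (V : finType) (e : rel V).
Local Notation kV := {ffun V -> k^o}.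
Local Notation basis_vec := (@basis_vec k V).
Local Notation coord_space := (@coord_space k V).
Implicit Types (H : collection k e) (T U : tube e) (tau : {set {set V}}).

Lemma act_ggrass t H : ggrass k e H -> ggrass k e (act t H).
Proof. by rewrite -qactE; apply: qact_ggrass. Qed.

Lemma supp_act t H T : supp (act t H) T = supp H T.
Proof.
suff sub s H' v : basis_vec v \in H' T -> basis_vec v \in act s H' T.
  apply/setP => v; rewrite !inE; congr (_ && ~~ _); apply/idP/idP; last exact: sub.
  by move/(sub t^-1%g); rewrite -actM mulVg act1.
move=> vH; have -> : basis_vec v = (Gm_val (s v))^-1 *: diag_map s (basis_vec v).
  apply/ffunP => u; rewrite [RHS]ffunE diag_mapE !ffunE /GRing.scale /=.
  case: eqVneq => [->|_]; last by rewrite !mulr0.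
  by rewrite mulr1 mulVf ?Gm_neq0.
by rewrite memvZ // memv_img.
Qed.

Definition sum_on (A : {set V}) (x : kV) : k^o := \sum_(v in A) x v.

Lemma sum_on_linear A : linear (sum_on A).
Proof.
move=> a x y; rewrite /sum_on scaler_sumr -big_split; apply: eq_bigr => v _.
by rewrite !ffunE.
Qed.

HB.instance Definition _ A :=
  GRing.isLinear.Build k kV k^o *:%R (sum_on A) (sum_on_linear A).

Section Nested.
Variable tau : {set {set V}}.
Hypothesis tau_nested : nested_set e tau.

(** The normal form of a point in the stratum of [tau]: all functionals have coefficients 0 and
    1. *)
Definition base_point : collection k e := fun U =>
  (coord_space (val U) :&: lker (linfun (sum_on (label tau (hull tau (val U))))))%VS.

Lemma mem_base_point U x :
  (x \in base_point U) = (x \in coord_space (val U)) &&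
    (sum_on (label tau (hull tau (val U))) x == 0).
Proof. by rewrite memv_cap memv_ker lfunE. Qed.

Lemma sum_on_basis A v : sum_on A (basis_vec v) = (v \in A)%:R.
Proof.
rewrite /sum_on; have [vA|vA] := boolP (v \in A).
  rewrite (bigD1 v) //= big1 ?addr0 => [|u /andP[_ ne]].
    by rewrite ffunE eqxx.
  by rewrite ffunE (negPf ne).
rewrite big1 // => u uA; rewrite ffunE.
by case: eqVneq uA => // ->; rewrite (negPf vA).
Qed.

Lemma supp_base_point U :
  supp base_point U = label tau (hull tau (val U)) :&: val U.
Proof.
apply/setP => v; rewrite in_setI andbC in_set; case vU: (v \in val U) => //=.
rewrite mem_base_point basis_vec_coord //= sum_on_basis.
by case: (v \in label _ _); rewrite ?oner_eq0 ?eqxx.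
Qed.

(** The label of the hull meets [U], so the functional is onto and its kernel is a hyperplane. For
    [U] inside [U'], either the hulls agree, or the label of the larger hull misses [U] and its
    functional vanishes there. *)
Lemma base_point_ggrass : ggrass k e base_point.
Proof.
split=> [U|U|U U' sU].
- exact: capvSl.
- set f := linfun (sum_on (label tau (hull tau (val U)))).
  have := limg_ker_dim f (coord_space (val U)); rewrite dim_coord_space => <-.
  suff -> : (f @: coord_space (val U))%VS = fullv by rewrite dimvf addn1.
  have [v vU vl] := hull_label_meet tau_nested (valP U).
  apply/eqP; rewrite eqEsubv subvf /=; apply/subvP => a _.
  apply/memv_imgP; exists (a *: basis_vec v).
    by rewrite memvZ ?basis_vec_coord.
  by rewrite linearZ /= lfunE /= sum_on_basis vl /GRing.scale /= mulr1.
apply/subvP => x; rewrite !mem_base_point => /andP[xU x0].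
rewrite (subvP (coord_space_mono _ sU)) //=.
have tU := hull_nested tau_nested (valP U).
have [<- //|neq] := eqVneq (hull tau (val U)) (hull tau (val U')).
have pU : hull tau (val U) \proper hull tau (val U').
  by rewrite properEneq neq hull_mono.
rewrite /sum_on big1 // => v /labelP[_ /(_ _ tU pU) vl].
have /mem_coord_space-> // := xU.
by apply: contra vl; apply: (subsetP (sub_hull _ _)).
Qed.

Lemma supp_label_base_point : supp_label base_point tau.
Proof.
move=> T Ttau; rewrite supp_base_point.
suff -> : hull tau (val T) = val T.
  by apply/setIidPl/subsetP => v /labelP[].
by apply/eqP; rewrite eqEsubset sub_hull hull_min.
Qed.

Lemma supp_label_act t H : supp_label H tau -> supp_label (act t H) tau.
Proof. by move=> sH T /sH <-; apply: supp_act. Qed.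

(* Every H_U is cut out by the functional at hull U, and the labels partition
   V, so the functionals of H and H' at members of tau can be matched by
   rescaling each coordinate once. *)
Lemma supp_label_orbit H H' :
  ggrass k e H -> ggrass k e H' -> supp_label H tau -> supp_label H' tau ->
  exists t, forall U, H U = act t H' U.
Proof.
move=> gH gH' lH lH'.
have functional H1 : ggrass k e H1 -> exists c : tube e -> V -> k,
    forall T x, x \in coord_space (val T) ->
      (x \in H1 T) = (\sum_v c T v * x v == 0).
  case=> s d _; apply: (fin_all_exists (U := fun=> V -> k)
    (P := fun T c => forall x, x \in coord_space (val T) ->
      (x \in H1 T) = (\sum_v c v * x v == 0))) => T.
  exact: hyperplane_functional (tube_neq0 T) (s T) (d T).
have [c cP] := functional H gH; have [c' cP'] := functional H' gH'.
have basis_sum (d : V -> k) v : \sum_u d u * basis_vec v u = d v.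
  rewrite (bigD1 v) //= big1 ?addr0 => [|u ne].
    by rewrite ffunE eqxx mulr1.
  by rewrite ffunE (negPf ne) mulr0.
have c0 T v : v \in val T -> (c T v != 0) = (v \in supp H T).
  by move=> vT; rewrite inE vT cP ?basis_vec_coord // basis_sum.
have c0' T v : v \in val T -> (c' T v != 0) = (v \in supp H' T).
  by move=> vT; rewrite inE vT cP' ?basis_vec_coord // basis_sum.
have hull_in S : S \in tubes e -> hull tau S \in tau by apply: hull_nested.
have hull_tube S : S \in tubes e -> hull tau S \in tubes e.
  by move=> tS; apply: (nested_tube tau_nested); apply: hull_in.
pose Tv v := mkTube (hull_tube _ (tube1 e v)).
have Tv_label v : v \in label tau (val (Tv v)).
  by have [_ /set1P->] := hull_label_meet tau_nested (tube1 e v).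
have Tv_tau v : val (Tv v) \in tau by apply/hull_in/tube1.
have Tv_in v : v \in val (Tv v) by have /labelP[] := Tv_label v.
(* [Tv v] is the member whose label contains [v], so both coefficients are nonzero. Scaling by this
   ratio pulls the functional of [H] at each member back to that of [H']. *)
have t_neq0 v : c' (Tv v) v / c (Tv v) v != 0.
  by rewrite mulf_neq0 ?invr_eq0 ?c0 ?c0' // ?lH ?lH'.
pose t : torus k V := [ffun v => MkGm (t_neq0 v)].
exists t => U; have [_ dH _] := gH; have [_ dtH' _] := act_ggrass t gH'.
apply/esym/eqP; rewrite eqEdim dH dtH' leqnn andbT.
apply/subvP => _ /memv_imgP[y yU ->].
have [v0 v0U v0l] := hull_label_meet tau_nested (valP U).
pose T := mkTube (hull_tube _ (valP U)).
have Ttau : val T \in tau by apply: hull_in (valP U).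
have sUT : val U \subset val T by apply: sub_hull.
have [sH' _ _] := gH'; have yc := subvP (sH' U) _ yU.
have tyc : diag_map t y \in coord_space (val U).
  by apply: (subvP (act_coord_space t (val U))); apply: memv_img.
have sT := subvP (coord_space_mono k sUT).
rewrite (ggrass_restrict gH sUT v0U) // ?lH // cP ?sT //.
have : y \in H' T by rewrite -(ggrass_restrict gH' sUT v0U) // ?lH'.
rewrite cP' ?sT // => /eqP y0; apply/eqP; rewrite -[RHS]y0; apply: eq_bigr => v _.
rewrite diag_mapE ffunE /=.
have [vT|vT] := boolP (v \in val T); last first.
  by have /mem_coord_space/(_ v vT)-> := sT _ yc; rewrite !mulr0.
have [vl|vl] := boolP (v \in label tau (val T)).
  have -> : Tv v = T.
    by apply: val_inj; apply: esym; exact: (label_hull tau_nested Ttau vl).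
  by rewrite mulrA [c T v * _]mulrC divfK // c0 // lH.
have /eqP-> : c T v == 0 by rewrite -[_ == _]negbK c0 // lH.
have /eqP-> : c' T v == 0 by rewrite -[_ == _]negbK c0' // lH'.
by rewrite !mul0r.
Qed.

End Nested.
End Orbits.

(* The stratification by torus orbits *)
From mathcomp Require Import boolp classical_sets.

Theorem theorem3p4 (k : fieldType) (char_k : [pchar k]%R =i pred0)
    (V : finType) (e : rel V)
    (e_sym : symmetric e) (e_irr : irreflexive e)
    (V_conn : finset.setT \in tubes e) :
  [/\ forall tau1 tau2 : {set {set V}},
        nested_set e tau1 -> nested_set e tau2 -> tau1 <> tau2 ->
        (gstratum k e tau1 `&` gstratum k e tau2 = classical_sets.set0)%classic,
      (\bigcup_(tau in [set tau | nested_set e tau]) gstratum k e tau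
         = ggrass k e)%classic
    & forall tau : {set {set V}}, nested_set e tau ->
        exists2 H : collection k e, gstratum k e tau H &
          gstratum k e tau = qorbit H].
Proof.
have unique tau H : nested_set e tau -> gstratum k e tau H -> tau = nested_of H.
  move=> ntau strH; have [gH _ _] := strH.
  apply: (supp_label_nested_of gH ntau).
  exact: (gstratum_supp_label e_sym gH ntau strH).
split=> [tau1 tau2 n1 n2 neq||tau ntau].
- rewrite -subset0 => H [/(unique _ _ n1) e1 /(unique _ _ n2) e2].
  by apply: neq; rewrite e1 e2.
- apply/seteqP; split=> [H [tau _ []] //|H gH].
  exists (nested_of H); first exact: (nested_of_nested e_sym gH V_conn).
  apply: supp_label_gstratum => //.
    exact: (nested_of_nested e_sym gH V_conn).
  exact: (nested_of_label e_sym gH).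
have gB := base_point_ggrass k ntau.
have lB := @supp_label_base_point k V e tau.
exists (base_point k tau); first exact: supp_label_gstratum.
(* Rescaling carries the base point to any point of the stratum; conversely the action preserves
   supports, hence the stratum. *)
apply/seteqP; split=> [H strH|_ [g _ <-]].
  have [gH _ _] := strH.
  have lH := gstratum_supp_label e_sym gH ntau strH.
  have [t tP] := supp_label_orbit ntau gH gB lH lB.
  by exists (qproj t) => //; rewrite qactE; apply/funext => U; rewrite tP.
apply: supp_label_gstratum => //; first exact: qact_ggrass.
exact: supp_label_act.
Qed.
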